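(* Let $r_1,r_2$ be handshake actions (names) and $t_1,t_2,e$ pairwise distinct output actions of CCS$^!$. There does not exist a CCS$^!$ expression $F$ such that, for both $i\in\{1,2\}$: (1) every complete path of $F$ on which $r_i$ occurs only finitely often is $r_i$-enabled; (2) on every complete path of $F$, each occurrence of $r_i$ is followed (later on the path) by an occurrence of $t_i$; (3) on every finite path of $F$ there are no more occurrences of $t_i$ than of $r_i$; and (4) on every path of $F$, between any two occurrences of actions from $\{t_1,t_2\}$ there is an occurrence of $e$.
   Context: CCS$^!$: fix a set $\mathcal A$ of names, a set $\mathcal K$ of agent identifiers and a set $O$ of output actions. Co-names are $\bar{\mathcal A}=\{\bar a\mid a\in\mathcal A\}$; the handshake actions are $H=\mathcal A\uplus\bar{\mathcal A}$ with $\bar{\bar a}=a$; the actions are $Act=H\uplus O\uplus\{\tau\}$. Actions in $O\cup\{\tau\}$ are called non-blocking. A relabelling is a function $f:H\to H$ with $f(\bar a)=\overline{f(a)}$, extended to $Act$ by $f(\alpha)=\alpha$ for $\alpha\in O\cup\{\tau\}$. CCS$^!$ expressions form the smallest set containing: agent identifiers $A\in\mathcal K$; $\alpha.P$ ($\alpha\in Act$); $\sum_{i\in I}P_i$ for any index set $I$; $P|Q$; $P\backslash a$ ($a\in H$); $P[f]$ ($f$ a relabelling). Each $A\in\mathcal K$ has a defining equation $A\stackrel{def}{=}P$. The labelled transition system (LTS) has transitions derived by the rules: $\alpha.P\xrightarrow{\alpha}P$; if $P_j\xrightarrow{\alpha}P'$ and $j\in I$ then $\sum_{i\in I}P_i\xrightarrow{\alpha}P'$;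 if $P\xrightarrow{\alpha}P'$ then $P|Q\xrightarrow{\alpha}P'|Q$; if $Q\xrightarrow{\alpha}Q'$ then $P|Q\xrightarrow{\alpha}P|Q'$; if $P\xrightarrow{a}P'$ and $Q\xrightarrow{\bar a}Q'$ ($a\in H$) then $P|Q\xrightarrow{\tau}P'|Q'$; if $P\xrightarrow{\alpha}P'$ and $a\neq\alpha\neq\bar a$ then $P\backslash a\xrightarrow{\alpha}P'\backslash a$; if $P\xrightarrow{\alpha}P'$ then $P[f]\xrightarrow{f(\alpha)}P'[f]$; if $P\xrightarrow{\alpha}P'$ and $A\stackrel{def}{=}P$ then $A\xrightarrow{\alpha}P'$. A path of $P$ is an alternating sequence of states and transitions, starting with the state $P$, either infinite or ending in a state, where each transition goes from the state before it to the state after it. An action occurs on a path if some transition of the path carries that label. Decomposition: a transition $P|Q\xrightarrow{\alpha}R$ derives from either a transition $P\xrightarrow{\alpha}P'$ and state $Q$ with $R=P'|Q$, or two transitions $P\xrightarrow{\alpha_1}P'$, $Q\xrightarrow{\alpha_2}Q'$ with $R=P'|Q'$, or a state $P$ and a transition $Q\xrightarrow{\alpha}Q'$ with $R=P|Q'$; such a pair is a decomposition of the transition (not necessarily unique). A decomposition of a path $\eta$ of $P|Q$ into paths $\eta_1$ of $P$ and $\eta_2$ of $Q$ is obtained by decomposing each transition of $\eta$ and concatenating all left components into $\eta_1$ and all right components into $\eta_2$ (one of them may be finite even if $\eta$ is infinite). Similarly a transition $P[f]\xrightarrow{\alpha}P'[f]$ stems from some $P\xrightarrow{\beta}P'$ with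 $f(\beta)=\alpha$, and a decomposition of a path of $P[f]$ is a path of $P$ obtained by decomposing each transition; likewise for $P\backslash c$. Justness: $Y$-justness, for $Y\subseteq H$, is the largest family of predicates on paths of the LTS such that: a finite $Y$-just path ends in a state all of whose outgoing transitions have labels in $Y$; a $Y$-just path of $P|Q$ can be decomposed into an $X$-just path of $P$ and a $Z$-just path of $Q$ with $X\cup Z\subseteq Y$ and $X\cap\bar Z=\emptyset$ (where $\bar Z=\{\bar c\mid c\in Z\}$); a $Y$-just path of $P\backslash c$ can be decomposed into a $Y\cup\{c,\bar c\}$-just path of $P$; a $Y$-just path of $P[f]$ can be decomposed into an $f^{-1}(Y)$-just path of $P$; every suffix of a $Y$-just path is $Y$-just. A path is just (= complete) if it is $Y$-just for some $Y\subseteq H$. A path $\eta$ is $a$-enabled, for $a\in H$, if $a\in Y$ for every $Y$ such that $\eta$ is $Y$-just.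
   Formalization: The handshake actions r_1 and r_2 are required to be different; for r_1=r_2=r the claim fails, e.g. F=(C|S)\req with C=r.(\bar{req}.0|C) and S=req.t_1.e.t_2.e.S satisfies (1)-(4). *)

(* Defs.v *)
From mathcomp Require Import all_boot.
From mathcomp Require Import boolp classical_sets functions cardinality.

Set Implicit Arguments.
Unset Strict Implicit.
Unset Printing Implicit Defensive.

Local Open Scope classical_set_scope.

(* Handshake actions: the disjoint union of the names and the co-names. *)
Inductive handshake (A : Type) : Type :=
| Name of A
| CoName of A.

Definition co (A : Type) (c : handshake A) : handshake A :=
  match c with Name a => CoName a | CoName a => Name a end.

Inductive action (A O : Type) : Type :=
| Hs of handshake A
| Out of O
| Tau.
Arguments Hs {A O} _.
Arguments Out {A O} _.
Arguments Tau {A O}.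

Record relabelling (A : Type) : Type := Relabelling {
  rel_fun :> handshake A -> handshake A;
  rel_co : forall c, rel_fun (co c) = co (rel_fun c)
}.

Definition rel_act (A O : Type) (f : relabelling A) (x : action A O) :
    action A O :=
  match x with Hs c => Hs (f c) | Out o => Out o | Tau => Tau end.

Inductive expr (A K O : Type) : Type :=
| Agent of K
| Prefix of action A O & expr A K O
| Sum (I : Type) of (I -> expr A K O)
| Par of expr A K O & expr A K O
| Restrict of expr A K O & handshake A
| Relabel of expr A K O & relabelling A.
Arguments Agent {A K O} _.
Arguments Prefix {A K O} _ _.
Arguments Sum {A K O I} _.
Arguments Par {A K O} _ _.
Arguments Restrict {A K O} _ _.
Arguments Relabel {A K O} _ _.

(* [def k] is the right-hand side of the defining equation of the agent
   identifier [k]. *)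
Inductive trans (A K O : Type) (def : K -> expr A K O) :
    expr A K O -> action A O -> expr A K O -> Prop :=
| t_prefix x P : trans def (Prefix x P) x P
| t_sum (I : Type) (P : I -> expr A K O) (j : I) x P' :
    trans def (P j) x P' -> trans def (Sum P) x P'
| t_parl P Q x P' : trans def P x P' -> trans def (Par P Q) x (Par P' Q)
| t_parr P Q x Q' : trans def Q x Q' -> trans def (Par P Q) x (Par P Q')
| t_comm P Q c P' Q' :
    trans def P (Hs c) P' -> trans def Q (Hs (co c)) Q' ->
    trans def (Par P Q) Tau (Par P' Q')
| t_restrict P c x P' :
    trans def P x P' -> x <> Hs c -> x <> Hs (co c) ->
    trans def (Restrict P c) x (Restrict P' c)
| t_relabel P f x P' :
    trans def P x P' -> trans def (Relabel P f) (rel_act f x) (Relabel P' f)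
| t_agent k x P' : trans def (def k) x P' -> trans def (Agent k) x P'.

(* A sequence of states and labels with [plen] transitions, infinite when
   [plen = None]; transition number [i] goes from [pstate i] to [pstate i.+1].
   The values of [pstate] beyond [plen], and of [plabel] from [plen] on, carry
   no information, and no definition below looks at them. *)
Record path (A K O : Type) : Type := Path {
  plen : option nat;
  pstate : nat -> expr A K O;
  plabel : nat -> action A O
}.

Definition has_trans (A K O : Type) (p : path A K O) (i : nat) : Prop :=
  match plen p with None => True | Some n => i < n end.

Definition has_state (A K O : Type) (p : path A K O) (i : nat) : Prop :=
  match plen p with None => True | Some n => i <= n end.

Definition finite_path (A K O : Type) (p : path A K O) : Prop :=
  exists n, plen p = Some n.

Definition is_path_of (A K O : Type) (def : K -> expr A K O) (P : expr A K O)
    (p : path A K O) : Prop :=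
  pstate p 0 = P /\
  forall i, has_trans p i -> trans def (pstate p i) (plabel p i) (pstate p i.+1).

Definition occurrences (A K O : Type) (p : path A K O) (x : action A O) :
    set nat :=
  [set i | has_trans p i /\ plabel p i = x].

(* Only meaningful when [has_state p n]. *)
Definition suffix (A K O : Type) (n : nat) (p : path A K O) : path A K O :=
  Path (omap (fun m => m - n) (plen p))
       (fun i => pstate p (n + i)) (fun i => plabel p (n + i)).

(* [l i] and [r i] count the left and right components among the first [i]
   transitions of [p]. The two equivalences say that the transitions of [p1]
   and [p2] are exactly these components: without them a component path could
   go on after the point from which [p] no longer uses it. *)
Definition par_decomposition (A K O : Type) (def : K -> expr A K O)
    (P Q : expr A K O) (p p1 p2 : path A K O) : Prop :=
  is_path_of def P p1 /\ is_path_of def Q p2 /\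
  exists l r : nat -> nat,
    l 0 = 0 /\ r 0 = 0 /\
    (forall i, has_state p i ->
       pstate p i = Par (pstate p1 (l i)) (pstate p2 (r i))) /\
    (forall i, has_trans p i ->
       [\/ [/\ l i.+1 = (l i).+1, r i.+1 = r i &
               plabel p i = plabel p1 (l i)],
           [/\ l i.+1 = l i, r i.+1 = (r i).+1 &
               plabel p i = plabel p2 (r i)] |
           [/\ l i.+1 = (l i).+1, r i.+1 = (r i).+1, plabel p i = Tau &
               exists c, plabel p1 (l i) = Hs c /\
                         plabel p2 (r i) = Hs (co c)]]) /\
    (forall j, has_trans p1 j <->
       exists i, has_trans p i /\ l i = j /\ l i.+1 = j.+1) /\
    (forall j, has_trans p2 j <->
       exists i, has_trans p i /\ r i = j /\ r i.+1 = j.+1).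

Definition restrict_decomposition (A K O : Type) (def : K -> expr A K O)
    (P : expr A K O) (c : handshake A) (p p1 : path A K O) : Prop :=
  is_path_of def P p1 /\ plen p1 = plen p /\
  (forall i, has_state p i -> pstate p i = Restrict (pstate p1 i) c) /\
  (forall i, has_trans p i -> plabel p i = plabel p1 i).

Definition relabel_decomposition (A K O : Type) (def : K -> expr A K O)
    (P : expr A K O) (f : relabelling A) (p p1 : path A K O) : Prop :=
  is_path_of def P p1 /\ plen p1 = plen p /\
  (forall i, has_state p i -> pstate p i = Relabel (pstate p1 i) f) /\
  (forall i, has_trans p i -> plabel p i = rel_act f (plabel p1 i)).

Definition justness_family (A K O : Type) (def : K -> expr A K O)
    (J : set (handshake A) -> path A K O -> Prop) : Prop :=
  forall Y p, J Y p ->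
    is_path_of def (pstate p 0) p /\
    (forall n, plen p = Some n ->
       forall x Q, trans def (pstate p n) x Q -> exists2 c, Y c & x = Hs c) /\
    (forall P Q, pstate p 0 = Par P Q ->
       exists p1 p2 X Z,
         par_decomposition def P Q p p1 p2 /\ J X p1 /\ J Z p2 /\
         X `|` Z `<=` Y /\ X `&` (@co A @` Z) = set0) /\
    (forall P c, pstate p 0 = Restrict P c ->
       exists p1, restrict_decomposition def P c p p1 /\
                  J (Y `|` [set c; co c]) p1) /\
    (forall P f, pstate p 0 = Relabel P f ->
       exists p1, relabel_decomposition def P f p p1 /\
                  J (rel_fun f @^-1` Y) p1) /\
    (forall n, has_state p n -> J Y (suffix n p)).

(* The largest family is the union of all families, the closure conditions
   being monotone in [J]. *)
Definition just (A K O : Type) (def : K -> expr A K O)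
    (Y : set (handshake A)) (p : path A K O) : Prop :=
  exists J, justness_family def J /\ J Y p.

Definition complete_path (A K O : Type) (def : K -> expr A K O)
    (p : path A K O) : Prop :=
  exists Y, just def Y p.

Definition enabled (A K O : Type) (def : K -> expr A K O)
    (c : handshake A) (p : path A K O) : Prop :=
  forall Y, just def Y p -> Y c.

(* Main.v *)
(* A transition is tagged with its place in the tree of parallel compositions,
   so that transitions with disjoint places commute.  A path is just as soon as
   every transition with a non-blocking label that is enabled at some point is
   later disturbed at its place (possibly by being performed); such fair paths
   are obtained by serving all pending transitions in turn.
   If a scheduler [F] existed, it would have a fair path [p] with infinitely
   many [r1], hence infinitely many [t1], and without [r2], hence without [t2].
   As [p] is [r2]-enabled, from some time on [r2] is offered by a component that
   [p] never uses again.  Perform [r2] there, and continue by interleaving [p]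
   with what the components that are idle in the rest of [p] can do among
   themselves.  This yields another just path, on which [t2] must occur, as an
   action of those components.  Their activity up to this [t2] commutes with the
   rest of [p], so it can be shifted such that a [t1] of [p] immediately precedes
   [t2]: no [e] occurs in between. *)
Require Import Defs.
From mathcomp Require Import all_boot.
From mathcomp Require Import boolp classical_sets functions cardinality.

Set Implicit Arguments.
Unset Strict Implicit.
Unset Printing Implicit Defensive.

(** * Places of transitions and their independence *)

(* The place of a transition in the tree of parallel compositions; [tB] is a
   handshake.  Restrictions and relabellings leave no mark. *)
Inductive place : Type := tS | tL of place | tR of place | tB of place & place.

(** Encoding into a countable type, so that [pickle] can enumerate the places to be served. *)
Fixpoint place_tree (t : place) : GenTree.tree unit :=
  match t with
  | tS => GenTree.Leaf tt
  | tL t => GenTree.Node 0 [:: place_tree t]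
  | tR t => GenTree.Node 1 [:: place_tree t]
  | tB t u => GenTree.Node 2 [:: place_tree t; place_tree u]
  end.

Fixpoint tree_place (g : GenTree.tree unit) : option place :=
  match g with
  | GenTree.Leaf _ => Some tS
  | GenTree.Node 0 [:: g] => omap tL (tree_place g)
  | GenTree.Node 1 [:: g] => omap tR (tree_place g)
  | GenTree.Node 2 [:: g; h] =>
      if (tree_place g, tree_place h) is (Some t, Some u) then Some (tB t u)
      else None
  | _ => None
  end.

Lemma place_treeK : pcancel place_tree tree_place.
Proof. by elim=> //= [t ->|t ->|t -> u ->]. Qed.

(* [conc t u]: a transition placed at [t] is unaffected by one placed at [u]. *)
Fixpoint conc (t u : place) : bool :=
  match t, u with
  | tL t, tL u => conc t u
  | tL _, tR _ => true
  | tL t, tB u _ => conc t u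
  | tR _, tL _ => true
  | tR t, tR u => conc t u
  | tR t, tB _ u => conc t u
  | tB t _, tL u => conc t u
  | tB _ t, tR u => conc t u
  | tB t1 t2, tB u1 u2 => conc t1 u1 && conc t2 u2
  | _, _ => false
  end.

Lemma conc_irrefl t : conc t t = false.
Proof. by elim: t => //= t -> . Qed.

Definition in_left (t : place) : bool := if t is (tL _ | tB _ _) then true else false.
Definition in_right (t : place) : bool := if t is (tR _ | tB _ _) then true else false.
Definition left_place (t : place) : place := if t is (tL u | tB u _) then u else tS.
Definition right_place (t : place) : place := if t is (tR u | tB _ u) then u else tS.

(** The length is the least number outside [T], if any. The conclusion has the shape of [has_trans],
    so [len] can serve as the [plen] of a path whose transitions are indexed by [T]. *)
Lemma length_exists (T : nat -> Prop) :
  (forall i j, i <= j -> T j -> T i) ->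
  exists len : option nat, forall k,
    (match len with None => True | Some n => k < n end) <-> T k.
Proof.
move=> down; have [all|/existsNP[N nT]] := pselect (forall k, T k).
  by exists None => k; split.
have ex : exists n, `[< ~ T n >] by exists N; apply/asboolP.
case: (ex_minnP ex) => n /asboolP nTn mn; exists (Some n) => k; split.
  by move=> kn; apply: contrapT => /asboolP/mn; rewrite leqNgt kn.
by move=> Tk; rewrite ltnNge; apply/negP => nk; apply: nTn; exact: down Tk.
Qed.

(** * Tagged transitions and their commutation *)

Section Justness.
Context {A K O : Type} (def : K -> expr A K O).
Local Notation expr := (expr A K O).
Local Notation action := (action A O).
Local Notation path := (Defs.path A K O).
Local Open Scope classical_set_scope.
Implicit Types (p : path) (P Q : expr) (x : action) (t u : place).

(** [tt_sum] and [tt_agent] discard the inner place: performing a transition there removes the whole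
    sum or identifier, so it conflicts with every other transition of that component. *)
Inductive ttrans : expr -> place -> action -> expr -> Prop :=
| tt_prefix x P : ttrans (Prefix x P) tS x P
| tt_sum (I : Type) (P : I -> expr) (j : I) t x P' :
    ttrans (P j) t x P' -> ttrans (Sum P) tS x P'
| tt_parl P Q t x P' : ttrans P t x P' -> ttrans (Par P Q) (tL t) x (Par P' Q)
| tt_parr P Q t x Q' : ttrans Q t x Q' -> ttrans (Par P Q) (tR t) x (Par P Q')
| tt_comm P Q t u c P' Q' :
    ttrans P t (Hs c) P' -> ttrans Q u (Hs (co c)) Q' ->
    ttrans (Par P Q) (tB t u) Tau (Par P' Q')
| tt_restrict P c t x P' :
    ttrans P t x P' -> x <> Hs c -> x <> Hs (co c) ->
    ttrans (Restrict P c) t x (Restrict P' c)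
| tt_relabel P f t x P' :
    ttrans P t x P' -> ttrans (Relabel P f) t (rel_act f x) (Relabel P' f)
| tt_agent k t x P' : ttrans (def k) t x P' -> ttrans (Agent k) tS x P'.

Lemma ttrans_trans P t x Q : ttrans P t x Q -> trans def P x Q.
Proof.
elim=> {P t x Q}.
- exact: t_prefix.
- by move=> I P j t x P' _; exact: t_sum.
- by move=> *; exact: t_parl.
- by move=> *; exact: t_parr.
- by move=> P Q t u c P' Q' _ + _; exact: t_comm.
- by move=> *; exact: t_restrict.
- by move=> *; exact: t_relabel.
- by move=> *; exact: t_agent.
Qed.

Lemma trans_ttrans P x Q : trans def P x Q -> exists t, ttrans P t x Q.
Proof.
elim=> {P x Q}.
- by move=> x P; exists tS; exact: tt_prefix.
- by move=> I P j x P' _ [t h]; exists tS; exact: tt_sum h.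
- by move=> P Q x P' _ [t ?]; exists (tL t); exact: tt_parl.
- by move=> P Q x Q' _ [t ?]; exists (tR t); exact: tt_parr.
- by move=> P Q c P' Q' _ [t ?] _ [u ?]; exists (tB t u); exact: (tt_comm (c := c)).
- by move=> P c x P' _ [t ?] ? ?; exists t; exact: tt_restrict.
- by move=> P f x P' _ [t ?]; exists t; exact: tt_relabel.
- by move=> k x P' _ [t h]; exists tS; exact: tt_agent h.
Qed.

Lemma ttrans_par P Q t x S : ttrans (Par P Q) t x S ->
  match t with
  | tS => False
  | tL t => exists2 P', ttrans P t x P' & S = Par P' Q
  | tR t => exists2 Q', ttrans Q t x Q' & S = Par P Q'
  | tB t u => x = Tau /\ exists c P' Q', [/\ ttrans P t (Hs c) P',
       ttrans Q u (Hs (co c)) Q' & S = Par P' Q']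
  end.
Proof.
by move=> h; inversion h; subst; [exists P'|exists Q'|split=> //; exists c, P', Q'].
Qed.

Lemma ttrans_restrict P c t x S : ttrans (Restrict P c) t x S ->
  exists P', [/\ ttrans P t x P', x <> Hs c, x <> Hs (co c) & S = Restrict P' c].
Proof. by move=> h; inversion h; subst; exists P'. Qed.

Lemma ttrans_relabel P f t x S : ttrans (Relabel P f) t x S ->
  exists P' y, [/\ ttrans P t y P', x = rel_act f y & S = Relabel P' f].
Proof. by move=> h; inversion h; subst; exists P', x0. Qed.

(** On each branch that they share, concurrent places separate at some parallel composition, where
    the two transitions change different components. For handshakes the induction hypothesis is
    needed only on the shared sides. *)
Lemma diamond P t x P1 u y P2 :
  ttrans P t x P1 -> ttrans P u y P2 -> conc t u ->
  exists2 Q, ttrans P1 u y Q & ttrans P2 t x Q.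
Proof.
move=> h; elim: h u y P2 => {P t x P1} //.
- move=> P Q t x P' h ih [|u|u|u1 u2] y P2 /ttrans_par //.
  + case=> P'' h' -> /= /(ih _ _ _ h') [R h1 h2].
    by exists (Par R Q); exact: tt_parl.
  + by case=> Q' h' -> _; exists (Par P' Q'); [exact: tt_parr|exact: tt_parl].
  + case=> -> [c [P'' [Q' [h1 h2 ->]]]] /= /(ih _ _ _ h1) [R h3 h4].
    by exists (Par R Q'); [exact: tt_comm h3 h2|exact: tt_parl].
- move=> P Q t x Q' h ih [|u|u|u1 u2] y P2 /ttrans_par //.
  + by case=> P' h' -> _; exists (Par P' Q'); [exact: tt_parl|exact: tt_parr].
  + case=> Q'' h' -> /= /(ih _ _ _ h') [R h1 h2].
    by exists (Par P R); exact: tt_parr.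
  + case=> -> [c [P' [Q'' [h1 h2 ->]]]] /= /(ih _ _ _ h2) [R h3 h4].
    by exists (Par P' R); [exact: tt_comm h1 h3|exact: tt_parr].
- move=> P Q t1 t2 c P' Q' h1 ih1 h2 ih2 [|u|u|u1 u2] y P2 /ttrans_par //.
  + case=> P'' h' -> /= /(ih1 _ _ _ h') [R h3 h4].
    by exists (Par R Q'); [exact: tt_parl|exact: tt_comm h4 h2].
  + case=> Q'' h' -> /= /(ih2 _ _ _ h') [R h3 h4].
    by exists (Par P' R); [exact: tt_parr|exact: tt_comm h1 h4].
  + case=> -> [d [P'' [Q'' [h3 h4 ->]]]] /= /andP[].
    move=> /(ih1 _ _ _ h3) [R h5 h6] /(ih2 _ _ _ h4) [R' h7 h8].
    by exists (Par R R'); [exact: tt_comm h5 h7|exact: tt_comm h6 h8].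
- move=> P c t x P' h ih nc nco u y P2 /ttrans_restrict.
  case=> P'' [h' yc yco ->] /(ih _ _ _ h') [R h1 h2].
  by exists (Restrict R c); exact: tt_restrict.
- move=> P f t x P' h ih u y P2 /ttrans_relabel.
  case=> P'' [z [h' -> ->]] /(ih _ _ _ h') [R h1 h2].
  by exists (Relabel R f); exact: tt_relabel.
Qed.

Lemma persistence (st : nat -> expr) (tg : nat -> place) (lab : nat -> action)
    t x i k :
  i <= k ->
  (forall j, i <= j < k -> ttrans (st j) (tg j) (lab j) (st j.+1)) ->
  (forall j, i <= j < k -> conc t (tg j)) ->
  (exists Q, ttrans (st i) t x Q) -> exists Q, ttrans (st k) t x Q.
Proof.
move=> /subnK <-; elim: (k - i) => [|d ih] hs hc //= hi.
rewrite addSn in hs hc *.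
have [] := ih _ _ hi.
- by move=> j /andP[ij jd]; apply: hs; rewrite ij ltnW.
- by move=> j /andP[ij jd]; apply: hc; rewrite ij ltnW.
move=> Q hQ.
have [||R _ hR] := diamond hQ (hs (d + i) _); last by exists R.
- by rewrite leq_addl /=.
- by apply: hc; rewrite leq_addl /=.
Qed.

(** * Persistent transitions, fair paths and projections to components *)

Definition placed (p : path) (tg : nat -> place) : Prop :=
  forall i, has_trans p i -> ttrans (pstate p i) (tg i) (plabel p i) (pstate p i.+1).

(** As [conc] is irreflexive, such a transition is not performed from time [i] on either; by
    [placed_persistence] it stays on offer for good. *)
Definition persistent (p : path) (tg : nat -> place) (x : action) : Prop :=
  exists i t Q, [/\ has_state p i, ttrans (pstate p i) t x Q &
    forall j, i <= j -> has_trans p j -> conc t (tg j)].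

Definition persistent_hs p tg : set (handshake A) :=
  [set c | persistent p tg (Hs c)].

Definition fair p tg : Prop := forall x, persistent p tg x -> exists c, x = Hs c.

Lemma has_trans_le p i j : i <= j -> has_trans p j -> has_trans p i.
Proof. by rewrite /has_trans; case: plen => // n /leq_ltn_trans; apply. Qed.

Lemma has_state_le p i j : i <= j -> has_state p j -> has_state p i.
Proof. by rewrite /has_state; case: plen => // n /leq_trans; apply. Qed.

Lemma has_state_lt p i j : i < j -> has_state p j -> has_trans p i.
Proof. by rewrite /has_state /has_trans; case: plen => // n /leq_trans; apply. Qed.

Lemma has_transS p i : has_trans p i = has_state p i.+1.
Proof. by []. Qed.

Lemma has_state0 p : has_state p 0.
Proof. by rewrite /has_state; case: plen. Qed.

Lemma has_transW p i : has_trans p i -> has_state p i.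
Proof. by rewrite has_transS; exact: has_state_le. Qed.

Lemma placed_persistence p tg t x i k :
  placed p tg -> i <= k -> has_state p k ->
  (forall j, i <= j -> has_trans p j -> conc t (tg j)) ->
  (exists Q, ttrans (pstate p i) t x Q) -> exists Q, ttrans (pstate p k) t x Q.
Proof.
move=> tp ik sk hc; apply: (persistence (tg := tg) (lab := plabel p)) => //.
- by move=> j /andP[ij jk]; apply: tp; exact: has_state_lt sk.
- by move=> j /andP[ij jk]; apply: hc => //; exact: has_state_lt sk.
Qed.

Lemma placed_path p tg : placed p tg -> is_path_of def (pstate p 0) p.
Proof. by move=> tp; split=> // i /tp/ttrans_trans. Qed.

(* The component path at time [i] is the [l i]-th position of [p1], where
   [l i] counts the earlier times at which [b] holds. *)
Lemma projection (p : path) (b : nat -> bool) (sp : nat -> expr)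
    (tp : nat -> place) (xp : nat -> action) (l := fun i => count b (iota 0 i)) :
  (forall i, has_trans p i -> if b i then ttrans (sp i) (tp i) (xp i) (sp i.+1)
                              else sp i.+1 = sp i) ->
  exists p1 tg1,
    [/\ placed p1 tg1,
        forall i, has_state p i -> sp i = pstate p1 (l i),
        forall i, has_trans p i -> b i ->
          plabel p1 (l i) = xp i /\ tg1 (l i) = tp i,
        forall k, has_trans p1 k <-> exists i, [/\ has_trans p i, l i = k & b i] &
        forall k, has_state p1 k <-> exists i, has_state p i /\ l i = k].
Proof.
move=> hp.
have lS i : l i.+1 = b i + l i.
  by rewrite /l -[in LHS]addn1 iotaD count_cat /= add0n addn0 addnC.
have lmon i j : i <= j -> l i <= l j.
  move=> /subnK <-; elim: (j - i) => // d ih.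
  by rewrite addSn lS (leq_trans ih) ?leq_addl.
have lstr i j : i < j -> b i -> l i < l j.
  by move=> /lmon ij bi; rewrite (leq_trans _ ij) // lS bi.
have spl i j : i <= j -> has_state p j -> l i = l j -> sp i = sp j.
  move=> /subnK <-; elim: (j - i) => // d ih; rewrite addSn => sj.
  have ij : l i <= l (d + i) by apply: lmon; rewrite leq_addl.
  rewrite lS => e; have := hp _ sj.
  case: (b _) e => [e|]; first by move: ij; rewrite e ltnn.
  by rewrite add0n => e ->; apply: ih => //; exact: has_transW.
have spE i j : has_state p i -> has_state p j -> l i = l j -> sp i = sp j.
  move=> si sj e; case/orP: (leq_total i j) => h; first exact: spl.
  by symmetry; exact: spl.
have bE i j : b i -> b j -> l i = l j -> i = j.
  by move=> bi bj e; case: (ltngtP i j) => // /lstr h; move: (h ltac:(done)); rewrite e ltnn.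
(* Position [k] of the component path may be occupied during several times; [fs k] is any of them,
   which is harmless by [spE]. The time [ft k] of transition [k] is unique by [bE]. *)
have [fs hfs] : {fs : nat -> nat & forall k, (exists i, has_state p i /\ l i = k) ->
    has_state p (fs k) /\ l (fs k) = k}.
  apply: (choice (P := fun k m => (exists i, has_state p i /\ l i = k) ->
    has_state p m /\ l m = k)) => k.
  have [[i hi]|h] := pselect (exists i, has_state p i /\ l i = k); first by exists i.
  by exists 0 => /h.
have [ft hft] : {ft : nat -> nat & forall k,
    (exists i, [/\ has_trans p i, l i = k & b i]) ->
    [/\ has_trans p (ft k), l (ft k) = k & b (ft k)]}.
  apply: (choice (P := fun k m => (exists i, [/\ has_trans p i, l i = k & b i]) ->
    [/\ has_trans p m, l m = k & b m])) => k.
  have [[i hi]|h] := pselect (exists i, [/\ has_trans p i, l i = k & b i]); first by exists i.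
  by exists 0 => /h.
have lonto i k : k < l i -> exists j, [/\ j < i, l j = k & b j].
  elim: i => // i ih; rewrite lS.
  case bi: (b i); last by rewrite add0n => /ih [j [ji ? ?]]; exists j; rewrite ltnW.
  rewrite add1n ltnS leq_eqVlt => /predU1P[->|/ih [j [ji ? ?]]]; first by exists i.
  by exists j; rewrite ltnW.
pose hT k := exists i, [/\ has_trans p i, l i = k & b i].
have hTlt i k : has_state p i -> k < l i -> hT k.
  move=> si /lonto [j [ji <- bj]]; exists j; split=> //; exact: has_state_lt si.
have [|len hlen] := length_exists (T := hT).
  move=> k m km [i [ti li bi]]; apply: (hTlt i.+1) => //.
  by rewrite lS bi li add1n ltnS.
pose p1 := Path len (fun k => sp (fs k)) (fun k => xp (ft k)).
have hst k : has_state p1 k <-> exists i, has_state p i /\ l i = k.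
  have sE j : has_state p1 j <-> (j = 0 \/ exists2 m, j = m.+1 & hT m).
    case: j => [|j]; first by split; [left|move=> _; exact: has_state0].
    rewrite -has_transS; split=> [/hlen h|[//|[m [<-]]]]; last by move/hlen.
    by right; exists j.
  split.
    case/sE => [->|[m -> [i [ti li bi]]]].
      by exists 0; split=> //; exact: has_state0.
    by exists i.+1; rewrite lS bi li.
  case=> i [si <-]; apply/sE.
  case e: (l i) => [|m]; first by left.
  by right; exists m => //; apply: hTlt si _; rewrite e.
exists p1, (fun k => tp (ft k)); split=> //.
- move=> k /[dup] tk /hlen hk; have [ti li bi] := hft _ hk.
  have := hp _ ti; rewrite bi.
  have [|sk lk] := hfs k; first by exists (ft k); split=> //; exact: has_transW.
  have [|sk1 lk1] := hfs k.+1; first by exists (ft k).+1; rewrite lS bi li.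
  rewrite /= (spE (fs k) (ft k)) ?lk //; last exact: has_transW.
  by rewrite (spE (fs k.+1) (ft k).+1) ?lk1 // lS bi li.
- move=> i si /=; have [|sk lk] := hfs (l i); first by exists i.
  exact: spE.
- move=> i ti bi /=; have [|tk lk bk] := hft (l i); first by exists i.
  by rewrite (bE _ _ bk bi lk).
Qed.

(** * Fair paths are just *)

Lemma conc_tL t u : ~~ conc (tL t) u -> u <> tS ->
  in_left u /\ ~~ conc t (left_place u).
Proof. by case: u. Qed.

Lemma conc_tR t u : ~~ conc (tR t) u -> u <> tS ->
  in_right u /\ ~~ conc t (right_place u).
Proof. by case: u. Qed.

Lemma conc_tB t1 t2 u : ~~ conc (tB t1 t2) u -> u <> tS ->
  in_left u /\ ~~ conc t1 (left_place u) \/ in_right u /\ ~~ conc t2 (right_place u).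
Proof.
case: u => //= [u|u|u1 u2]; [by left|by right|rewrite negb_and].
by case/orP; [left|right].
Qed.

(** The candidate for a justness family: the closure conditions are verified for it one by one
    below. *)
Definition tjust (Y : set (handshake A)) p : Prop :=
  exists tg, [/\ placed p tg, fair p tg & persistent_hs p tg `<=` Y].

(** [p] is projected to both sides, and [X], [Z] are the persistent handshakes of the projections.
    What persists in a component persists in [p] at a place [tL t] or [tR t]. If complementary
    handshakes persisted on the two sides, their synchronisation would be a persistent [Tau],
    against fairness. *)
Lemma tjust_par Y p P Q : tjust Y p -> pstate p 0 = Par P Q ->
  exists p1 p2 X Z,
    par_decomposition def P Q p p1 p2 /\ tjust X p1 /\ tjust Z p2 /\
    X `|` Z `<=` Y /\ X `&` (@co A @` Z) = set0.
Proof.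
case=> tg [tp fp sp] p0.
pose lf (e : expr) := if e is Par P _ then P else e.
pose rt (e : expr) := if e is Par _ Q then Q else e.
have pE i : has_state p i -> pstate p i = Par (lf (pstate p i)) (rt (pstate p i)).
  elim: i => [|i ih] si; first by rewrite p0.
  have := tp _ si; rewrite ih; last exact: has_state_le si.
  move/ttrans_par; case: (tg i) => //.
  - by move=> t [P' _ ->].
  - by move=> t [P' _ ->].
  - by move=> t u [_ [c [P' [Q' [_ _ ->]]]]].
have tgS i : has_trans p i -> tg i <> tS.
  move=> ti e; have := tp _ ti; rewrite e pE; last exact: has_transW.
  by move/ttrans_par.
(* [y] holds the labels of the left and right components of transition [i]; on a side that does not
   move, the label is arbitrary. *)
pose good i (y : action * action) := has_trans p i ->
  [/\ if in_left (tg i) then ttrans (lf (pstate p i)) (left_place (tg i)) y.1 (lf (pstate p i.+1))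
      else lf (pstate p i.+1) = lf (pstate p i),
      if in_right (tg i) then ttrans (rt (pstate p i)) (right_place (tg i)) y.2 (rt (pstate p i.+1))
      else rt (pstate p i.+1) = rt (pstate p i) &
      [\/ [/\ in_left (tg i), in_right (tg i) = false & plabel p i = y.1],
          [/\ in_left (tg i) = false, in_right (tg i) & plabel p i = y.2] |
          [/\ in_left (tg i), in_right (tg i), plabel p i = Tau &
              exists c, y.1 = Hs c /\ y.2 = Hs (co c)]]].
have [y hy] : {y & forall i, good i (y i)}.
  apply: choice => i; have [ti|] := pselect (has_trans p i); last by exists (Tau, Tau).
  have := tp _ ti; rewrite (pE i); last exact: has_transW.
  rewrite /good /=; move/ttrans_par; case: (tg i) => //=.
  - move=> t [P' h ->]; exists (plabel p i, Tau) => _; split=> //.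
    by apply: Or31.
  - move=> t [P' h ->]; exists (Tau, plabel p i) => _; split=> //.
    by apply: Or32.
  - move=> t u [xT [c [P' [Q' [h1 h2 ->]]]]]; exists (Hs c, Hs (co c)) => _; split=> //.
    by apply: Or33; split=> //; exists c.
pose bl i := in_left (tg i); pose br i := in_right (tg i).
pose l i := count bl (iota 0 i); pose r i := count br (iota 0 i).
have lS i : l i.+1 = bl i + l i.
  by rewrite /l -[in LHS]addn1 iotaD count_cat /= add0n addn0 addnC.
have rS i : r i.+1 = br i + r i.
  by rewrite /r -[in LHS]addn1 iotaD count_cat /= add0n addn0 addnC.
have mono (b : nat -> bool) i j : i <= j -> count b (iota 0 i) <= count b (iota 0 j).
  by move=> ij; rewrite -(subnKC ij) iotaD count_cat leq_addr.
have [|p1 [tg1 [tp1 sl1 ll1 ht1 hs1]]] :=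
  projection (p := p) (b := bl) (sp := fun i => lf (pstate p i))
    (tp := fun i => left_place (tg i)) (xp := fun i => (y i).1).
  by move=> i /hy [].
have [|p2 [tg2 [tp2 sl2 ll2 ht2 hs2]]] :=
  projection (p := p) (b := br) (sp := fun i => rt (pstate p i))
    (tp := fun i => right_place (tg i)) (xp := fun i => (y i).2).
  by move=> i /hy [].
have perl k t x S : has_state p1 k -> ttrans (pstate p1 k) t x S ->
    (forall j, k <= j -> has_trans p1 j -> conc t (tg1 j)) -> persistent p tg x.
  case/hs1 => i [si li] h hc; exists i, (tL t), (Par S (rt (pstate p i))).
  split=> //; first by rewrite (pE i) //; apply: tt_parl; rewrite sl1 // li.
  move=> j ij tj; apply: contrapT => /negP /conc_tL [|bj]; first exact: tgS.
  have [_ e] := ll1 _ tj bj; rewrite -e => /negP; apply; apply: hc.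
    by rewrite -li; exact: mono.
  by apply/ht1; exists j.
have perr k t x S : has_state p2 k -> ttrans (pstate p2 k) t x S ->
    (forall j, k <= j -> has_trans p2 j -> conc t (tg2 j)) -> persistent p tg x.
  case/hs2 => i [si li] h hc; exists i, (tR t), (Par (lf (pstate p i)) S).
  split=> //; first by rewrite (pE i) //; apply: tt_parr; rewrite sl2 // li.
  move=> j ij tj; apply: contrapT => /negP /conc_tR [|bj]; first exact: tgS.
  have [_ e] := ll2 _ tj bj; rewrite -e => /negP; apply; apply: hc.
    by rewrite -li; exact: mono.
  by apply/ht2; exists j.
have p10 : pstate p1 0 = P by rewrite -[0]/(l 0) -sl1 ?p0 //; exact: has_state0.
have p20 : pstate p2 0 = Q by rewrite -[0]/(r 0) -sl2 ?p0 //; exact: has_state0.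
exists p1, p2, (persistent_hs p1 tg1), (persistent_hs p2 tg2).
split; [|split; [|split; [|split]]].
- split; first by rewrite -p10; exact: placed_path tp1.
  split; first by rewrite -p20; exact: placed_path tp2.
  exists l, r; do 2!split=> //; split.
    by move=> i si; rewrite -sl1 // -sl2 // -pE.
  split.
    move=> i ti; rewrite !lS !rS /bl /br; have [_ _ []] := hy _ ti.
    + by case=> bi -> ->; apply: Or31; rewrite bi; have [-> _] := ll1 _ ti bi.
    + by case=> -> bi ->; apply: Or32; rewrite bi; have [-> _] := ll2 _ ti bi.
    + case=> bi bi' -> [c [c1 c2]]; apply: Or33; rewrite bi bi'; split=> //; exists c.
      by have [-> _] := ll1 _ ti bi; have [-> _] := ll2 _ ti bi'.
  have onto (b : nat -> bool) i : b i <->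
      count b (iota 0 i.+1) = (count b (iota 0 i)).+1.
    rewrite -[i.+1]addn1 iotaD count_cat /= add0n addn0 addnC.
    by case: (b i) => //=; split=> // /n_Sn.
  split=> j; [split=> [/ht1|]|split=> [/ht2|]].
  + by case=> i [ti <- /onto e]; exists i.
  + by case=> i [ti [<- /onto e]]; apply/ht1; exists i.
  + by case=> i [ti <- /onto e]; exists i.
  + by case=> i [ti [<- /onto e]]; apply/ht2; exists i.
- by exists tg1; split=> // x [k [t [S [sk h hc]]]]; apply: fp; exact: perl h hc.
- by exists tg2; split=> // x [k [t [S [sk h hc]]]]; apply: fp; exact: perr h hc.
- by move=> c [] [k [t [S [sk h hc]]]]; apply: sp; [exact: perl h hc|exact: perr h hc].
- rewrite -subset0 => c0 [[k1 [t1 [S1 [/hs1[i1 [si1 li1]] h1 hc1]]]]].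
  case=> d [k2 [t2 [S2 [/hs2[i2 [si2 ri2]] h2 hc2]]]] dc; subst.
  (* From the later of the two times on, both partners are on offer together. *)
  pose i := maxn i1 i2.
  have si : has_state p i by rewrite /i; case: leqP.
  have sl : has_state p1 (l i) by apply/hs1; exists i.
  have sr : has_state p2 (r i) by apply/hs2; exists i.
  have hl : count bl (iota 0 i1) <= l i by apply: mono; exact: leq_maxl.
  have hr : count br (iota 0 i2) <= r i by apply: mono; exact: leq_maxr.
  have [|R1 hR1] := placed_persistence (x := Hs (co d)) tp1 hl sl hc1; first by exists S1; exact: h1.
  have [|R2 hR2] := placed_persistence (x := Hs d) tp2 hr sr hc2; first by exists S2; exact: h2.
  have [|c //] := fp Tau; exists i, (tB t1 t2), (Par R1 R2); split=> //.
    rewrite pE // sl1 // sl2 //; apply: tt_comm hR1 _.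
    by move: hR2; case: (d).
  move=> j ij tj; apply: contrapT => /negP /conc_tB [|[]|[]]; first exact: tgS.
    move=> bj; have [_ e] := ll1 _ tj bj; rewrite -e => /negP; apply; apply: hc1.
      by rewrite (leq_trans hl) //; exact: mono.
    by apply/ht1; exists j.
  move=> bj; have [_ e] := ll2 _ tj bj; rewrite -e => /negP; apply; apply: hc2.
    by rewrite (leq_trans hr) //; exact: mono.
  by apply/ht2; exists j.
Qed.

(** Persistence passes from the body to [p] except for the labels [c] and [co c], which the
    restriction blocks; the enlarged set makes room for these two. *)
Lemma tjust_restrict Y p P c : tjust Y p -> pstate p 0 = Restrict P c ->
  exists p1, restrict_decomposition def P c p p1 /\ tjust (Y `|` [set c; co c]) p1.
Proof.
case=> tg [tp fp sp] p0.
pose body (e : expr) := if e is Restrict P _ then P else e.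
have pE i : has_state p i -> pstate p i = Restrict (body (pstate p i)) c.
  elim: i => [|i ih] si; first by rewrite p0.
  have := tp _ si; rewrite ih; last exact: has_state_le si.
  by case/ttrans_restrict => P' [_ _ _ ->].
pose p1 := Path (plen p) (fun i => body (pstate p i)) (plabel p).
have tp1 : placed p1 tg.
  move=> i ti; have := tp _ ti; rewrite pE; last exact: has_transW.
  by rewrite (pE i.+1) //= => /ttrans_restrict[P' [? _ _ [->]]].
have pers x : persistent p1 tg x -> x <> Hs c -> x <> Hs (co c) ->
    persistent p tg x.
  case=> i [t [Q [si h hc]]] xc xco; exists i, t, (Restrict Q c); split=> //.
  by rewrite pE //; exact: tt_restrict.
exists p1; split.
  split; last by split=> //; split=> // i /pE.
  by have := placed_path tp1; rewrite [pstate p1 0]/= p0.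
exists tg; split=> //.
  move=> x hx; have [xc|xc] := pselect (x = Hs c); first by exists c.
  have [xco|xco] := pselect (x = Hs (co c)); first by exists (co c).
  by apply: fp; exact: pers.
move=> d hd; have [->|dc] := pselect (d = c); first by right; left.
have [->|dco] := pselect (d = co c); first by right; right.
by left; apply: sp; apply: pers hd _ _ => -[].
Qed.

(** Relabelling leaves places alone and keeps the distinction between handshakes and non-blocking
    actions, so persistence of [x] in the body becomes persistence of [rel_act f x] in [p]. *)
Lemma tjust_relabel Y p P f : tjust Y p -> pstate p 0 = Relabel P f ->
  exists p1, relabel_decomposition def P f p p1 /\ tjust (rel_fun f @^-1` Y) p1.
Proof.
case=> tg [tp fp sp] p0.
pose body (e : expr) := if e is Relabel P _ then P else e.
have pE i : has_state p i -> pstate p i = Relabel (body (pstate p i)) f.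
  elim: i => [|i ih] si; first by rewrite p0.
  have := tp _ si; rewrite ih; last exact: has_state_le si.
  by case/ttrans_relabel => P' [y [_ _ ->]].
have [y hy] : {y & forall i, has_trans p i -> plabel p i = rel_act f (y i) /\
    ttrans (body (pstate p i)) (tg i) (y i) (body (pstate p i.+1))}.
  apply: (choice (P := fun i z => has_trans p i -> plabel p i = rel_act f z /\
    ttrans (body (pstate p i)) (tg i) z (body (pstate p i.+1)))) => i.
  have [ti|] := pselect (has_trans p i); last by exists Tau.
  have := tp _ ti; rewrite pE; last exact: has_transW.
  by rewrite (pE i.+1) // => /ttrans_relabel[P' [z [? ? [->]]]]; exists z.
pose p1 := Path (plen p) (fun i => body (pstate p i)) y.
have tp1 : placed p1 tg by move=> i /hy [].
have pers x : persistent p1 tg x -> persistent p tg (rel_act f x).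
  case=> i [t [Q [si h hc]]]; exists i, t, (Relabel Q f); split=> //.
  by rewrite pE //; exact: tt_relabel.
exists p1; split.
  split; last by split=> //; split=> i; [exact: pE|case/hy].
  by have := placed_path tp1; rewrite [pstate p1 0]/= p0.
exists tg; split=> //.
  by case=> [c _|o|] => [|/pers/fp[]|/pers/fp[]] //; exists c.
by move=> c /pers; exact: sp.
Qed.

Lemma tjust_suffix Y p n : tjust Y p -> has_state p n ->
  tjust Y (Defs.suffix n p).
Proof.
case=> tg [tp fp sp] sn.
have sufT i : has_trans (Defs.suffix n p) i <-> has_trans p (n + i).
  rewrite /has_trans /=; case: (plen p) => [m|] //=.
  by rewrite ltn_subRL.
have sufS i : has_state (Defs.suffix n p) i <-> has_state p (n + i).
  move: sn; rewrite /has_state /=; case: (plen p) => [m|] //= nm.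
  by rewrite leq_subRL.
have pers x : persistent (Defs.suffix n p) (fun i => tg (n + i)) x ->
    persistent p tg x.
  case=> i [t [Q [/sufS si h hc]]]; exists (n + i), t, Q; split=> // j ij tj.
  have nj : n <= j := leq_trans (leq_addr i n) ij.
  rewrite -(subnKC nj); apply: hc; last by apply/sufT; rewrite subnKC.
  by rewrite leq_subRL.
exists (fun i => tg (n + i)); split.
- by move=> i /sufT /tp; rewrite /= addnS.
- by move=> x /pers /fp.
- by move=> c /pers /sp.
Qed.

(** A proof by coinduction: [just] asks for membership in some justness family, and [tjust] is
    one. *)
Lemma tjust_just Y p : tjust Y p -> just def Y p.
Proof.
move=> h; exists tjust; split=> // {h} {}Y {}p jp.
split; first by case: jp => tg [tp _ _]; exact: placed_path tp.
split.
  case: jp => tg [tp fp sp] n pn x Q /trans_ttrans[t h].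
  (* In the last state of a finite path every enabled transition is vacuously persistent. *)
  have px : persistent p tg x.
    exists n, t, Q; split=> //; first by rewrite /has_state pn.
    by move=> j nj; rewrite /has_trans pn ltnNge nj.
  by have [c xc] := fp _ px; exists c => //; apply: sp; rewrite /persistent_hs /= -xc.
split; first by move=> P Q; exact: tjust_par.
split; first by move=> P c; exact: tjust_restrict.
split; first by move=> P f; exact: tjust_relabel.
by move=> n; exact: tjust_suffix.
Qed.

Lemma fair_complete p tg : placed p tg -> fair p tg -> complete_path def p.
Proof. by move=> tp fp; exists setT; apply: tjust_just; exists tg. Qed.

(** A fair path is just already for its own set of persistent handshakes, which must therefore
    contain [c]. *)
Lemma enabled_persistent p tg c : placed p tg -> fair p tg ->
  enabled def c p -> persistent p tg (Hs c).
Proof. 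
by move=> tp fp en; apply: (en (persistent_hs p tg)); apply: tjust_just; exists tg; split=> // d.
Qed.

(** * Finite tagged runs *)

Definition nonblocking x : Prop := forall c, x <> Hs c.

(** A step stores its place, label and target state, so that a run is a list and prolonging it is
    concatenation. *)
Definition step : Type := (place * action * expr)%type.
Implicit Types (g s : seq step).

Definition run_path (F : expr) g : path :=
  Path (Some (size g)) (nth F (F :: [seq r.2 | r <- g]))
    (nth Tau [seq r.1.2 | r <- g]).
Definition run_place g : nat -> place := nth tS [seq r.1.1 | r <- g].
Definition run F g : Prop := placed (run_path F g) (run_place g).

Lemma run_state_cat F g s i : i <= size g ->
  pstate (run_path F (g ++ s)) i = pstate (run_path F g) i.
Proof. by move=> ig; rewrite /= map_cat -cat_cons nth_cat /= size_map ltnS ig. Qed.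

Lemma run_label_cat F g s i : i < size g ->
  plabel (run_path F (g ++ s)) i = plabel (run_path F g) i.
Proof. by move=> ig; rewrite /= map_cat nth_cat size_map ig. Qed.

Lemma run_place_cat g s i : i < size g -> run_place (g ++ s) i = run_place g i.
Proof. by move=> ig; rewrite /run_place map_cat nth_cat size_map ig. Qed.

Lemma run_place_last g t x Q : run_place (g ++ [:: (t, x, Q)]) (size g) = t.
Proof. by rewrite /run_place map_cat nth_cat size_map ltnn subnn. Qed.

Lemma run_label_last F g t x Q :
  plabel (run_path F (g ++ [:: (t, x, Q)])) (size g) = x.
Proof. by rewrite /= map_cat nth_cat size_map ltnn subnn. Qed.

Lemma run_state_last F g t x Q :
  pstate (run_path F (g ++ [:: (t, x, Q)])) (size g).+1 = Q.
Proof. by rewrite /= map_cat nth_cat size_map ltnn subnn. Qed.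

Lemma run_nil F : run F [::].
Proof. by []. Qed.

Lemma run_rcons F g t x Q : run F g ->
  ttrans (pstate (run_path F g) (size g)) t x Q -> run F (g ++ [:: (t, x, Q)]).
Proof.
move=> rg h i ti; have: i <= size g by move: ti; rewrite /has_trans /= size_cat addn1.
rewrite leq_eqVlt => /predU1P[->|ig].
  by rewrite run_place_last run_label_last run_state_last run_state_cat.
rewrite (run_place_cat _ ig) (run_label_cat F _ ig) (run_state_cat F _ ig).
by rewrite (run_state_cat F _ (ltnW ig)); apply: rg.
Qed.

Lemma run_is_path F g : run F g -> is_path_of def F (run_path F g).
Proof. exact: placed_path. Qed.

(** The obligation that fairness attaches to time [i] and place [t]; once met, it remains met in
    every extension. *)
Definition served F g (i : nat) t : Prop :=
  (exists x Q, nonblocking x /\ ttrans (pstate (run_path F g) i) t x Q) ->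
  exists2 j, i <= j < size g & ~~ conc t (run_place g j).

Lemma served_cat F g s i t : i <= size g -> served F g i t -> served F (g ++ s) i t.
Proof.
move=> ig sg; rewrite /served run_state_cat // => /sg[j /andP[ij jg] nc].
by exists j; rewrite ?run_place_cat // ij size_cat (leq_trans jg) ?leq_addr.
Qed.

Lemma served_last F g t x Q i : i <= size g -> served F (g ++ [:: (t, x, Q)]) i t.
Proof.
move=> ig _; exists (size g); first by rewrite ig size_cat addn1 leqnn.
by rewrite run_place_last conc_irrefl.
Qed.

(** A transition not disturbed so far is still enabled at the end of the run, by persistence, and
    can be served by performing it. *)
Lemma served_or_pending F g i t : run F g -> i <= size g ->
  served F g i t \/
  exists x Q, nonblocking x /\ ttrans (pstate (run_path F g) (size g)) t x Q.
Proof.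
move=> rg ig; have [|ns] := pselect (served F g i t); [by left|right].
have [[x [Q [nb h]]] nj] := (iffLR (not_implyP _ _)) ns.
have [|||R hR] := placed_persistence (x := x) (t := t) rg ig.
- exact: leqnn.
- move=> j ij jg; apply: contrapT => /negP nc; apply: nj; exists j => //.
  by rewrite ij.
- by exists Q.
by exists x, R.
Qed.

(** * Limits of growing runs and the construction of fair paths *)

Definition run_prefix F g p (tg : nat -> place) : Prop :=
  (forall i, i <= size g -> pstate p i = pstate (run_path F g) i) /\
  (forall i, i < size g -> [/\ has_trans p i,
     plabel p i = plabel (run_path F g) i & tg i = run_place g i]).

Lemma run_limit F (h : nat -> seq step) :
  (forall n, exists s, h n.+1 = h n ++ s) ->
  exists p tg, (forall n, run_prefix F (h n) p tg) /\
    (forall i, has_trans p i -> exists n, i < size (h n)).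
Proof.
move=> hS.
have hle m n : m <= n -> exists s, h n = h m ++ s.
  move=> /subnK <-; elim: (n - m) => [|d [s e]]; first by exists [::]; rewrite cats0.
  by have [s' e'] := hS (d + m); exists (s ++ s'); rewrite addSn e' e catA.
have [N hN] : {N : nat -> nat & forall i, (exists n, i < size (h n)) -> i < size (h (N i))}.
  apply: (choice (P := fun i m => (exists n, i < size (h n)) -> i < size (h m))) => i.
  by have [[n hn]|hn] := pselect (exists n, i < size (h n)); [exists n|exists 0 => /hn].
have same i m n : i < size (h m) -> i < size (h n) ->
    [/\ pstate (run_path F (h m)) i.+1 = pstate (run_path F (h n)) i.+1,
        plabel (run_path F (h m)) i = plabel (run_path F (h n)) i &
        run_place (h m) i = run_place (h n) i].
  have wl m' n' : m' <= n' -> i < size (h m') -> i < size (h n') ->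
    [/\ pstate (run_path F (h m')) i.+1 = pstate (run_path F (h n')) i.+1,
        plabel (run_path F (h m')) i = plabel (run_path F (h n')) i &
        run_place (h m') i = run_place (h n') i].
    move=> /hle [s ->] im _.
    by rewrite run_state_cat // run_label_cat // run_place_cat.
  case/orP: (leq_total m n) => mn im in_; first exact: wl.
  by have [-> -> ->] := wl _ _ mn in_ im.
have [len hlen] := length_exists (T := fun i => exists n, i < size (h n))
  (fun i j ij => fun '(ex_intro n hn) => ex_intro _ n (leq_ltn_trans ij hn)).
(* State [j.+1] is read off a stage that contains transition [j]; state 0 needs no stage, so the
   case in which all stages are empty is covered. *)
exists (Path len (fun i => if i is j.+1 then pstate (run_path F (h (N j))) i else F)
    (fun i => plabel (run_path F (h (N i))) i)), (fun i => run_place (h (N i)) i).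
split; last by move=> i /hlen.
move=> n; split.
- case=> // i ig; have [||e _ _] := same i (N i) n => //.
  by apply: hN; exists n.
- move=> i ig; have [||_ e1 e2] := same i (N i) n => //; first by apply: hN; exists n.
  by split=> //; apply/hlen; exists n.
Qed.

(** Dependent choice, with the number of the stage available to [R]. *)
Lemma chain_exists (T : Type) (I : T -> Prop) (R : nat -> T -> T -> Prop) (a : T) :
  I a -> (forall n b, I b -> exists b', I b' /\ R n b b') ->
  exists h : nat -> T, h 0 = a /\ forall n, I (h n) /\ R n (h n) (h n.+1).
Proof.
move=> Ia next_.
have [f hf] : {f : nat * T -> T & forall nb, I nb.2 -> I (f nb) /\ R nb.1 nb.2 (f nb)}.
  apply: (choice (P := fun nb b' => I nb.2 -> I b' /\ R nb.1 nb.2 b')) => -[n b].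
  have [/(next_ n)[b' hb']|] := pselect (I b); first by exists b'.
  by exists b.
pose h := fix h n := if n is m.+1 then f (m, h m) else a.
have Ih n : I (h n) by elim: n => //= n /(hf (n, h n)) [].
by exists h; split=> // n; split=> //; have [] := hf (n, h n) (Ih n).
Qed.

(** The dummy [m] gives every [x] arbitrarily large codes, so that an enumeration by codes returns
    to each task again and again. Otherwise [B.+1] distinct codes would fit below [B]. *)
Lemma unbounded_code (T : countType) (x : T) (B : nat) :
  exists m : nat, B <= pickle (m, x).
Proof.
apply: contrapT => /forallNP nB.
have lt (m : 'I_B.+1) : pickle (val m, x) < B by rewrite ltnNge; apply/negP.
have inj : injective (fun m => Ordinal (lt m)).
  by move=> m n [] /(pcan_inj pickleK) [] /ord_inj.
by have := leq_card _ inj; rewrite !card_ord ltnn.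
Qed.

(** Stage [n] serves the time and place coded by [n], provided that the run has already reached this
    time, and then achieves [good n]. Each pair returns under larger codes, so none is missed, and
    the limit is fair. [I] is the invariant of the stages. *)
Lemma fair_limit F (I : seq step -> Prop) (good : nat -> seq step -> Prop) g0 :
  (forall g, I g -> run F g) -> I g0 ->
  (forall g i t, I g -> i <= size g -> exists s, I (g ++ s) /\ served F (g ++ s) i t) ->
  (forall n g, I g -> exists s, I (g ++ s) /\ good n (g ++ s)) ->
  exists p tg h, [/\ placed p tg, fair p tg & h 0 = g0] /\
    [/\ forall n, I (h n), forall n, good n (h n.+1),
        forall n, run_prefix F (h n) p tg &
        forall i, has_trans p i -> exists n, i < size (h n)].
Proof.
move=> Irun I0 serve mkgood.
pose code n : option (nat * (nat * GenTree.tree unit)) := unpickle n.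
pose R n g g' := [/\ exists s, g' = g ++ s, good n g' &
  forall m i t, code n = Some (m, (i, place_tree t)) -> i <= size g -> served F g' i t].
have [||h [h0 hI]] := @chain_exists _ I R g0 => //.
  move=> n g Ig; have [s [Is hs]] : exists s, I (g ++ s) /\
      forall m i t, code n = Some (m, (i, place_tree t)) -> i <= size g ->
        served F (g ++ s) i t.
    case e: (code n) => [[m [i w]]|]; last by exists [::]; rewrite cats0.
    case: (leqP i (size g)) => ig; last first.
      by exists [::]; rewrite cats0; split=> // m' i' t [_ <- _]; rewrite leqNgt ig.
    have [[t et]|nt] := pselect (exists t, w = place_tree t); last first.
      by exists [::]; rewrite cats0; split=> // m' i' t [_ _ et]; case: nt; exists t.
    have [s [Is ss]] := serve g i t Ig ig; exists s; split=> // m' i' u [_ <-].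
    by rewrite et => /(pcan_inj place_treeK) <-.
  have [s' [Is' gs']] := mkgood n _ Is; exists (g ++ s ++ s'); rewrite catA.
  split=> //; split=> //; first by exists (s ++ s'); rewrite catA.
  move=> m i t e ig; apply: served_cat; last exact: hs e ig.
  by rewrite size_cat (leq_trans ig) ?leq_addr.
have hS n : exists s, h n.+1 = h n ++ s by case: (hI n) => _ [].
have [p [tg [pre cov]]] := run_limit F hS.
have sz m n : m <= n -> size (h m) <= size (h n).
  move=> /subnK <-; elim: (n - m) => // d ih.
  by rewrite addSn; have [s ->] := hS (d + m); rewrite size_cat (leq_trans ih) ?leq_addr.
have tp : placed p tg.
  move=> i /cov [n ig]; have [sp lp] := pre n; have [_ -> ->] := lp _ ig.
  rewrite (sp i (ltnW ig)) (sp i.+1 ig); apply: Irun ig; by case: (hI n).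
exists p, tg, h; split; split=> //; last 2 first.
- by move=> n; case: (hI n).
- by move=> n; case: (hI n) => _ [].
move=> x [i [t [Q [si hx hc]]]]; apply: contrapT => nx.
have [n0 in0] : exists n, i <= size (h n).
  case: i si {hx hc} => [|i] si; first by exists 0.
  by have [n hn] := cov i si; exists n.
(* The code must be so large that time [i] already exists at its stage. *)
have [m mn] := unbounded_code (i, place_tree t) n0.
have [_ [_ _ srv]] := hI (pickle (m, (i, place_tree t))).
have ig := leq_trans in0 (sz _ _ mn).
have [|j /andP[ij jg] nc] := srv m i t (pickleK _) ig.
  exists x, Q; split; first by move=> c xc; apply: nx; exists c.
  have [<- //] := pre (pickle (m, (i, place_tree t))).+1.
  by rewrite (leq_trans ig) // sz.
have [_ /(_ _ jg) [tj _ e]] := pre (pickle (m, (i, place_tree t))).+1.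
by move: nc; rewrite -e hc.
Qed.

Definition final F g : expr := pstate (run_path F g) (size g).

Lemma final_last F g t x Q : final F (g ++ [:: (t, x, Q)]) = Q.
Proof. by rewrite /final size_cat addn1 run_state_last. Qed.

Lemma run_prefix_state F g p tg : run_prefix F g p tg -> has_state p (size g).
Proof.
case: g => [|r g] [_ hg]; first exact: has_state0.
by have [] := hg (size g) (ltnSn _).
Qed.

Lemma path_prefix p tg n : placed p tg -> has_state p n ->
  exists g, [/\ size g = n, run (pstate p 0) g & run_prefix (pstate p 0) g p tg].
Proof.
move=> tp; elim: n => [_|n ih tn].
  by exists [::]; split=> //; split=> // -[].
have [g [sg rg [hs hl]]] := ih (has_transW tn).
exists (g ++ [:: (tg n, plabel p n, pstate p n.+1)]); split.
- by rewrite size_cat addn1 sg.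
- by apply: run_rcons rg _; rewrite -hs // sg; exact: tp.
split=> i; rewrite size_cat addn1 ?ltnS leq_eqVlt => /predU1P[->|ig].
- by rewrite run_state_last sg.
- by rewrite (run_state_cat _ _ ig); exact: hs.
- by rewrite run_label_last run_place_last sg.
- by rewrite (run_label_cat _ _ ig) (run_place_cat _ ig); exact: hl.
Qed.

(** * Fair paths on which a chosen handshake recurs *)

Lemma serve_step F g i t : run F g -> i <= size g ->
  exists s, [/\ run F (g ++ s), served F (g ++ s) i t &
    forall j, size g <= j < size (g ++ s) ->
      nonblocking (plabel (run_path F (g ++ s)) j)].
Proof.
move=> rg ig; have [sg|[x [Q [nb h]]]] := served_or_pending t rg ig.
  by exists [::]; rewrite cats0; split=> // j; case: leqP => // jg; rewrite ltnNge jg.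
exists [:: (t, x, Q)]; split; [exact: run_rcons|exact: served_last|].
move=> j; rewrite size_cat addn1 ltnS -eqn_leq => /eqP <-.
by rewrite run_label_last.
Qed.

(** Requirement (1) on the scheduler, for a single handshake. *)
Definition responsive F (c : handshake A) : Prop :=
  forall p, is_path_of def F p -> complete_path def p ->
    finite_set (occurrences p (Hs c)) -> enabled def c p.

(** Prolong [g] to a fair path by non-blocking steps only. There [c] occurs finitely often, so it is
    enabled and hence persistent. A stage late enough to include the offer can then be continued
    with [c]. *)
Lemma reach_handshake F g c : responsive F c -> run F g ->
  exists s t Q, run F (g ++ s ++ [:: (t, Hs c, Q)]) /\
    forall j, size g <= j < size (g ++ s) ->
      nonblocking (plabel (run_path F (g ++ s)) j).
Proof.
move=> resp rg.
pose I g' := exists s, [/\ g' = g ++ s, run F g' &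
  forall j, size g <= j < size g' -> nonblocking (plabel (run_path F g') j)].
have [| | | |p [tg [h [[tp fp h0] [hI _ pre cov]]]]] :=
  fair_limit (F := F) (I := I) (g0 := g) (good := fun _ _ => True).
- by move=> g' [s []].
- exists [::]; rewrite cats0; split=> // j.
  by case: leqP => // jg; rewrite ltnNge jg.
- move=> g' i t [s [-> rs nb]] ig; have [s' [rs' ss' nb']] := serve_step t rs ig.
  exists s'; split=> //; exists (s ++ s'); rewrite catA; split=> // j /andP[gj js].
  case: (ltnP j (size (g ++ s))) => jg; last by apply: nb'; rewrite jg.
  by rewrite (run_label_cat _ _ jg); apply: nb; rewrite gj.
- by move=> _ g' Ig'; exists [::]; rewrite cats0.
have p0 : pstate p 0 = F by have [-> ] := pre 0.
have : persistent p tg (Hs c).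
  apply: enabled_persistent => //; apply: resp.
  - by rewrite -p0; exact: placed_path tp.
  - exact: fair_complete fp.
  (* All occurrences of [c] lie within [g]. *)
  - apply: (sub_finite_set _ (finite_II (size g))) => i [ti ei] /=.
    have [n ni] := cov _ ti; have [s [e _ nb]] := hI n.
    rewrite ltnNge; apply/negP => gi.
    have [_ /(_ _ ni) [_ e' _]] := pre n.
    by apply: (nb i _ c); rewrite ?gi // -e'.
case=> i [t [Q [si hQ hc]]].
have [n ni] : exists n, i <= size (h n).
  case: i si {hQ hc} => [|i] si; first by exists 0.
  by have [n ni] := cov i si; exists n.
have [s [e rs nb]] := hI n; have [hs _] := pre n.
have [||R hR] := placed_persistence (x := Hs c) tp ni _ hc.
- exact: run_prefix_state (pre n).
- by exists Q.
exists s, t, R; rewrite catA -e; split=> //.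
by apply: run_rcons => //; rewrite -hs.
Qed.

(** Serving steps alternate with uses of [reach_handshake]. Neither performs a handshake other than
    [c]. *)
Lemma busy_path F c : responsive F c ->
  exists p tg, [/\ placed p tg, fair p tg, pstate p 0 = F,
    forall n, exists2 i, n <= i & occurrences p (Hs c) i &
    forall i, has_trans p i -> nonblocking (plabel p i) \/ plabel p i = Hs c].
Proof.
move=> resp.
pose ok g := forall j, j < size g ->
  nonblocking (plabel (run_path F g) j) \/ plabel (run_path F g) j = Hs c.
pose I g := run F g /\ ok g.
pose good n g := exists j, n <= j < size g /\ plabel (run_path F g) j = Hs c.
have okcat g s : ok g -> (forall j, size g <= j < size (g ++ s) ->
    nonblocking (plabel (run_path F (g ++ s)) j)) -> ok (g ++ s).
  move=> okg nb j js; case: (ltnP j (size g)) => jg; last by left; apply: nb; rewrite jg.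
  by rewrite (run_label_cat _ _ jg); exact: okg.
have oklast g t Q : ok g -> ok (g ++ [:: (t, Hs c, Q)]).
  move=> okg j; rewrite size_cat addn1 ltnS leq_eqVlt => /predU1P[->|jg].
    by right; rewrite run_label_last.
  by rewrite (run_label_cat _ _ jg); exact: okg.
have more g : I g -> exists s, I (g ++ s) /\ good (size g) (g ++ s).
  case=> rg okg; have [s [t [Q [rs nb]]]] := reach_handshake resp rg.
  exists (s ++ [:: (t, Hs c, Q)]); split; last first.
    exists (size (g ++ s)); rewrite catA run_label_last; split=> //.
    by rewrite !size_cat addn1 leqnn leq_addr.
  by split=> //; rewrite catA; apply: oklast; exact: okcat.
have [| | | |p [tg [h [[tp fp h0] [hI hgood pre cov]]]]] :=
  fair_limit (F := F) (I := I) (g0 := [::]) (good := good).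
- by move=> g [].
- by split=> //; exact: run_nil.
- move=> g i t [rg okg] ig; have [s [rs ss nb]] := serve_step t rg ig.
  by exists s; split=> //; split=> //; exact: okcat.
(* Each use of [more] places a [c] beyond the current end, so [n.+1] uses bring one to an index at
   least [n]. *)
- elim=> [|n ih] g Ig.
    have [s [Is [j [/andP[_ js] e]]]] := more g Ig; exists s; split=> //.
    by exists j; rewrite js.
  have [s [Is [j [/andP[nj js] _]]]] := ih g Ig.
  have [s' [Is' [j' [/andP[sj' j's] e']]]] := more _ Is.
  exists (s ++ s'); rewrite catA; split=> //; exists j'; rewrite j's andbT.
  by split=> //; rewrite (leq_trans _ sj') // (leq_ltn_trans nj).
exists p, tg; split=> //.
- by have [-> ] := pre 0.
- move=> n; have [j [/andP[nj js] e]] := hgood n; exists j => //.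
  by have [_ /(_ _ js) [tj e' _]] := pre n.+1; split=> //; rewrite e'.
- move=> i /cov [n ni]; have [_ okn] := hI n.
  by have [_ /(_ _ ni) [_ -> _]] := pre n; exact: okn.
Qed.

(** A word records no intermediate states, unlike a run, so the same word can be performed from
    another state after commuting it with other transitions. *)
Fixpoint acts P (w : seq (place * action)) Q : Prop :=
  if w is (t, x) :: w' then exists2 R, ttrans P t x R & acts R w' Q else P = Q.

Lemma acts_cat P w1 w2 Q :
  acts P (w1 ++ w2) Q <-> exists2 R, acts P w1 R & acts R w2 Q.
Proof.
elim: w1 P => [|[t x] w1 ih] P /=; first by split=> [|[_ <-]//]; exists P.
split=> [[S h /ih[R h1 h2]]|[R [S h h1] h2]]; first by exists R => //; exists S.
by exists S => //; apply/ih; exists R.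
Qed.

Lemma acts_conc P w Q u y P2 : acts P w Q -> ttrans P u y P2 ->
  all (fun a => conc a.1 u) w -> exists2 Q2, acts P2 w Q2 & ttrans Q u y Q2.
Proof.
elim: w P P2 => [|[t x] w ih] P P2 /= => [<- h _|[R h1 h2] h /andP[cu cw]].
  by exists P2.
have [S h3 h4] := diamond h1 h cu.
by have [Q2 h5 h6] := ih _ _ h2 h3 cw; exists Q2 => //; exists S.
Qed.

Lemma run_acts F g w Q : run F g -> acts (final F g) w Q ->
  exists s, run F (g ++ s) /\ final F (g ++ s) = Q.
Proof.
elim: w g => [|[t x] w ih] g rg /=; first by exists [::]; rewrite cats0.
case=> R h hw; have rg' := run_rcons rg h.
have [|s [rs fs]] := ih _ rg'; first by rewrite final_last.
by exists ((t, x, R) :: s); rewrite -cat_rcons -cats1.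
Qed.

(** * Interleaving an infinite path with its idle components *)

Section Interleave.
Context (p : path) (tg : nat -> place).
Hypotheses (tp : placed p tg) (pinf : forall i, has_trans p i).
Local Notation F := (pstate p 0).

(** [a] belongs to components that are idle in [p] from time [k] on. The label in [a] is carried
    along so that [all (stable k)] applies to words. *)
Definition stable k (a : place * action) : bool :=
  `[< forall j, k <= j -> conc a.1 (tg j) >].

Lemma stableW k m a : k <= m -> stable k a -> stable m a.
Proof. by move=> km /asboolP h; apply/asboolP => j mj; apply: h; exact: leq_trans mj. Qed.

Lemma stable_conc k w : all (stable k) w -> all (fun a => conc a.1 (tg k)) w.
Proof. by apply: sub_all => a /asboolP; apply. Qed.

Lemma acts_stable k m w R : k <= m -> all (stable k) w ->
  acts (pstate p k) w R -> exists R', acts (pstate p m) w R'.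
Proof.
move=> /subnK <-; elim: (m - k) => [|d ih] st h; first by exists R.
have [R' h'] := ih st h.
have [|Q h1 _] := acts_conc h' (tp (pinf (d + k))); last by exists Q.
by apply: stable_conc; apply: sub_all st => a; apply: stableW; rewrite leq_addl.
Qed.

(* [w] is what the components idle in [p] from time [k] on have done so far,
   while the others have followed [p] up to time [k]. *)
Definition interleaved k (w : seq (place * action)) g : Prop :=
  [/\ run F g, acts (pstate p k) w (final F g), all (stable k) w &
    forall j, j < size g -> (exists m, plabel (run_path F g) j = plabel p m) \/
      exists w1 t w2, w = w1 ++ (t, plabel (run_path F g) j) :: w2].

(** Transition [k] of [p] is still possible after [w], since the stable word commutes with it. *)
Lemma interleaved_advance k w g : interleaved k w g ->
  exists Q, interleaved k.+1 w (g ++ [:: (tg k, plabel p k, Q)]).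
Proof.
case=> rg ha st lab; have [|Q h1 h2] := acts_conc ha (tp (pinf k)).
  exact: stable_conc.
exists Q; split.
- exact: run_rcons.
- by rewrite final_last.
- by apply: sub_all st => a; exact: stableW.
move=> j; rewrite size_cat addn1 ltnS leq_eqVlt => /predU1P[->|jg].
  by left; exists k; rewrite run_label_last.
by rewrite (run_label_cat _ _ jg); exact: lab.
Qed.

Lemma interleaved_advances k w g d : interleaved k w g ->
  exists s, interleaved (d + k) w (g ++ s).
Proof.
move=> h; elim: d => [|d [s hs]]; first by exists [::]; rewrite cats0.
have [Q hQ] := interleaved_advance hs.
by exists (s ++ [:: (tg (d + k), plabel p (d + k), Q)]); rewrite catA addSn.
Qed.

Lemma interleaved_idle k w g t x Q : interleaved k w g ->
  ttrans (final F g) t x Q -> stable k (t, x) ->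
  interleaved k (w ++ [:: (t, x)]) (g ++ [:: (t, x, Q)]).
Proof.
case=> rg ha st lab h hk; split.
- exact: run_rcons.
- by apply/acts_cat; exists (final F g) => //=; rewrite final_last; exists Q.
- by rewrite all_cat st /= hk.
move=> j; rewrite size_cat addn1 ltnS leq_eqVlt => /predU1P[->|jg].
  by right; exists w, t, [::]; rewrite run_label_last.
rewrite (run_label_cat _ _ jg); have [|[w1 [u [w2 ->]]]] := lab _ jg; first by left.
by right; exists w1, u, (w2 ++ [:: (t, x)]); rewrite -catA.
Qed.

(** A pending transition at a stable place is performed as idle activity. Otherwise [p] disturbs its
    place at some time [m >= k], and following [p] through transition [m] serves it. *)
Lemma interleaved_serve k w g i t : interleaved k w g -> i <= size g ->
  exists s, (exists k' w', interleaved k' w' (g ++ s)) /\ served F (g ++ s) i t.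
Proof.
move=> h ig; have [rg _ _ _] := h.
have [sg|[x [Q [nb hx]]]] := served_or_pending t rg ig.
  by exists [::]; rewrite cats0; split=> //; exists k, w.
have [st|/asboolPn/existsNP[m /not_implyP[km nc]]] := boolP (stable k (t, x)).
  exists [:: (t, x, Q)]; split; last exact: served_last.
  by exists k, (w ++ [:: (t, x)]); exact: interleaved_idle.
have [s] := interleaved_advances (m - k) h; rewrite subnK // => hs.
have [R hR] := interleaved_advance hs.
exists (s ++ [:: (tg m, plabel p m, R)]); rewrite catA; split; first by exists m.+1, w.
move=> _; exists (size (g ++ s)); last by rewrite run_place_last; apply/negP.
by rewrite !size_cat addn1 leqnn (leq_trans ig) ?leq_addr.
Qed.

(** Follow [p] up to time [i0], perform [r] at its idle place, and take a fair limit of interleaved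
    runs. Every label then comes from [p] or from an idle word. *)
Lemma interleave i0 t0 r Q0 :
  ttrans (pstate p i0) t0 (Hs r) Q0 -> (forall j, i0 <= j -> conc t0 (tg j)) ->
  exists q, [/\ is_path_of def F q, complete_path def q, occurrences q (Hs r) i0 &
    forall j, has_trans q j -> (exists m, plabel q j = plabel p m) \/
      exists k w t R, acts (pstate p k) (w ++ [:: (t, plabel q j)]) R /\
        all (stable k) (w ++ [:: (t, plabel q j)])].
Proof.
move=> h0 c0.
have [g [sg rg [gst glab]]] := path_prefix tp (has_transW (pinf i0)).
have st0 : stable i0 (t0, Hs r) by apply/asboolP.
have fg : final F g = pstate p i0 by rewrite /final sg -gst ?sg.
have int0 : interleaved i0 [::] g.
  split=> // j /glab[_ e _]; first by left; exists j.
pose I g' := exists k w, interleaved k w g'.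
have [| | | |q [tq [h [[tqp fq h_0] [hI _ pre cov]]]]] :=
  fair_limit (F := F) (I := I) (g0 := g ++ [:: (t0, Hs r, Q0)])
    (good := fun _ _ => True).
- by move=> g' [k [w []]].
- by exists i0, [:: (t0, Hs r)]; apply: (interleaved_idle int0) => //; rewrite fg.
- by move=> g' i t [k [w hk]]; exact: interleaved_serve hk.
- by move=> _ g' Ig'; exists [::]; rewrite cats0.
exists q; split.
- have <- : pstate q 0 = F by have [-> ] := pre 0.
  exact: placed_path tqp.
- exact: fair_complete fq.
- have [_ /(_ i0)] := pre 0; rewrite h_0 size_cat addn1 sg => /(_ (ltnSn _)).
  by case=> ti e _; split=> //; rewrite e -sg run_label_last.
move=> j /cov [n nj]; have [_ /(_ _ nj) [_ -> _]] := pre n.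
have [k [w [_ ha st /(_ _ nj) [|[w1 [t [w2 e]]]]]]] := hI n; first by left.
(* The idle word is cut off right after the label in question. *)
right; move: ha st; rewrite e -cat_rcons -cats1 => /acts_cat[R ha _].
by rewrite all_cat => /andP[st _]; exists k, w1, t, R.
Qed.

(** Stability allows the idle word to start at time [m] instead of [k]. Performing [w], then
    transition [m] of [p], and only then [(t, x)] makes the two labels consecutive. *)
Lemma adjacent k m w t x R : k <= m -> all (stable k) (w ++ [:: (t, x)]) ->
  acts (pstate p k) (w ++ [:: (t, x)]) R ->
  exists q i, [/\ is_path_of def F q, occurrences q (plabel p m) i &
    occurrences q x i.+1].
Proof.
move=> km st /(acts_stable km st) [R' /acts_cat[S hw [T hx _]]].
move: st; rewrite all_cat /= andbT => /andP[stw stx].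
have [|S' _ hS] := acts_conc hw (tp (pinf m)).
  by apply: stable_conc; apply: sub_all stw => a; exact: stableW.
have [|T' _ hT] := diamond hx hS; first by move/asboolP: stx; apply.
have [g [sg rg [gst _]]] := path_prefix tp (has_transW (pinf m)).
have fg : final F g = pstate p m by rewrite /final sg -gst ?sg.
have [|s [rs fs]] := run_acts (w := w) (Q := S) rg; first by rewrite fg.
have hS' : ttrans (final F (g ++ s)) (tg m) (plabel p m) S' by rewrite fs.
have rs'' : run F (((g ++ s) ++ [:: (tg m, plabel p m, S')]) ++ [:: (t, x, T')]).
  by apply: run_rcons (run_rcons rs hS') _; rewrite -/(final F _) final_last.
exists (run_path F (((g ++ s) ++ [:: (tg m, plabel p m, S')]) ++ [:: (t, x, T')])),
  (size (g ++ s)).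
have sz : size ((g ++ s) ++ [:: (tg m, plabel p m, S')]) = (size (g ++ s)).+1.
  by rewrite size_cat addn1.
split; first exact: run_is_path.
- split; first by rewrite /has_trans /= !size_cat !addn1 ltnS leqnSn.
  by rewrite run_label_cat ?sz // run_label_last.
- split; first by rewrite /has_trans /= !size_cat !addn1.
  by rewrite -sz run_label_last.
Qed.

End Interleave.

End Justness.

(** * Non-existence of the scheduler *)

Theorem theorem1 (A K O : Type) (def : K -> expr A K O)
    (r1 r2 : handshake A) (t1 t2 e : O) :
  r1 <> r2 -> t1 <> t2 -> t1 <> e -> t2 <> e ->
  ~ exists F : expr A K O,
      forall (r : handshake A) (t : O),
        (r = r1 /\ t = t1) \/ (r = r2 /\ t = t2) ->
        (forall p, is_path_of def F p -> complete_path def p ->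
           finite_set (occurrences p (Hs r)) -> enabled def r p) /\
        (forall p, is_path_of def F p -> complete_path def p ->
           forall i, occurrences p (Hs r) i ->
             exists j, (i < j)%N /\ occurrences p (Out t) j) /\
        (forall p, is_path_of def F p -> finite_path p ->
           (occurrences p (Out t) #<= occurrences p (Hs r))%card) /\
        (forall p, is_path_of def F p ->
           forall i k, (i < k)%N ->
             (occurrences p (Out t1) i \/ occurrences p (Out t2) i) ->
             (occurrences p (Out t1) k \/ occurrences p (Out t2) k) ->
             exists j, (i < j < k)%N /\ occurrences p (Out e) j).
Proof.
move=> r12 _ _ _ [F spec].
have [resp1 [follow1 [_ sep]]] := spec r1 t1 (or_introl (conj erefl erefl)).
have [resp2 [follow2 [count2 _]]] := spec r2 t2 (or_intror (conj erefl erefl)).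
have [p [tg [tp fp p0 often only]]] := busy_path resp1.
have pF : is_path_of def F p by rewrite -p0; exact: placed_path tp.
have pc : complete_path def p := fair_complete tp fp.
have pinf i : has_trans p i.
  by have [j ij [tj _]] := often i; exact: has_trans_le ij tj.
have no_r2 i : plabel p i <> Hs r2.
  by move=> ei; have [/(_ r2)//|] := only _ (pinf i); rewrite ei => -[/esym].
have no_t2 m : plabel p m <> Out t2.
  (* The finite prefix ending with this [t2] would contain [t2] but no [r2], against requirement
     (3). *)
  move=> em; have [g [sg rg [_ glab]]] := path_prefix tp (pinf m : has_state p m.+1).
  rewrite p0 in rg glab.
  have := count2 _ (run_is_path rg) (ex_intro _ _ erefl).
  have -> : occurrences (run_path F g) (Hs r2) = set0.
    rewrite -subset0 => j [jg]; have [_ <- _] := glab j jg; exact: no_r2.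
  move/card_le0P; rewrite -subset0 => /(_ m); apply; split.
    by rewrite /has_trans /= sg.
  by have [|_ <- _] := glab m; rewrite ?sg.
have [i0 [t0 [Q0 [_ h0 c0]]]] : persistent def p tg (Hs r2).
  apply: enabled_persistent fp _ => //; apply: resp2 => //.
  have -> : occurrences p (Hs r2) = set0.
    by rewrite -subset0 => j [_]; exact: no_r2.
  exact: finite_set0.
have [q [qF qc qr2 orig]] := interleave tp pinf h0 (fun j ij => c0 j ij (pinf j)).
rewrite p0 in qF.
have [j [_ [tj ej]]] := follow2 _ qF qc _ qr2.
(* This [t2] is not a label of [p], so it ends a word [w ++ [:: (t, _)]] of idle activity. *)
have [[m em]|[k [w [t [R [hw st]]]]]] := orig j tj.
  by apply: (no_t2 m); rewrite -em.
have [n kn [_ en]] := often k; have [m [nm [_ em]]] := follow1 _ pF pc n (conj (pinf n) en).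
have [q' [i [q'F qi qi1]]] := adjacent tp pinf (leq_trans kn (ltnW nm)) st hw.
rewrite p0 in q'F; rewrite em in qi; rewrite ej in qi1.
have [l [/andP[il li] _]] := sep _ q'F i i.+1 (ltnSn i) (or_introl qi) (or_intror qi1).
by move: (leq_trans il li); rewrite ltnn.
Qed.
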